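(* For any single unit-demand buyer with value distribution $\mathcal{D}$ over $m$ items and any ex-ante constraint $x\in\Delta_m$, $$\textsc{BuyManyRev}(\mathcal{D},x)\leq O(\log m)\,\textsc{SRev}(\mathcal{D},x),$$ with an absolute constant in $O(\cdot)$.
   Context: $\Delta_m=\{\lambda\in[0,1]^m:\sum_j\lambda_j\le1\}$. Unit-demand buyer: valuation $v$ with $v_j\ge0$ per item, $v(S)=\max_{j\in S}v_j$; the distribution $\mathcal{D}$ is arbitrary (correlated across items). A lottery $\lambda\in\Delta_m$ has value $v(\lambda)=\sum_jv_j\lambda_j$. A pricing function $p$ assigns a price $p(\lambda)\ge0$ to every lottery; a buyer of type $v$ chooses $\lambda_{v,p}\in\arg\max_\lambda(v(\lambda)-p(\lambda))$ and pays $p(\lambda_{v,p})$. $p$ is buy-many if no buyer type can obtain higher utility by adaptively purchasing a (random) sequence of lotteries (each choice depending on previous outcomes), getting the union of the allocated items and paying the sum of prices, than by buying one lottery. An item pricing is a vector of item prices $(p_1,\dots,p_m)\in\mathbb{R}_+^m$ (buyer buys an item maximizing $v_j-p_j$ if nonnegative). A random pricing $p$ (distribution over pricings) satisfies ex-ante constraint $x$ w.r.t. $\mathcal{D}$ if $\mathbb{E}_{v\sim\mathcal{D},p}[\lambda_{v,p}]\preceq x$ componentwise. $\textsc{SRev}(\mathcal{D},x)$ (resp. $\textsc{BuyManyRev}(\mathcal{D},x)$) is the maximum expected revenue over distributions over item pricings (resp. over buy-many pricings) satisfying $x$ w.r.t. $\mathcal{D}$.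
   Formalization: Pricing functions are additionally required to give the empty lottery price 0 (the buyer may opt out for free); without this a constant price on all lotteries is buy-many and makes BuyManyRev unbounded. O(log m) is read as C·ln(m+1), covering m = 1. *)

(* Defs.v *)
From HB Require Import structures.
From mathcomp Require Import all_boot all_order all_algebra.
From mathcomp Require Import all_classical all_reals all_analysis measurable_realfun.
Set Implicit Arguments. Unset Strict Implicit. Unset Printing Implicit Defensive.
Import Order.TTheory GRing.Theory Num.Theory.
Local Open Scope ring_scope.

Section Defs.
Variable R : realType.
Variable m : nat.

Definition vec := 'I_m -> R.

Definition valuation (v : vec) : Prop := forall j, 0 <= v j.

Definition lottery (l : vec) : Prop :=
  (forall j, 0 <= l j <= 1) /\ \sum_j l j <= 1.

Definition lval (v l : vec) : R := \sum_j v j * l j.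

Definition setval (v : vec) (S : {set 'I_m}) : R := \big[Num.max/0]_(j in S) v j.

Definition lot0 : vec := fun _ => 0.

Definition pricing_fn (p : vec -> R) : Prop :=
  (forall l, lottery l -> 0 <= p l) /\ p lot0 = 0.

(* Adaptive purchasing strategies: finite-depth decision trees.  At a node
   [Buy l k] the buyer buys lottery [l]; the outcome is [Some j] (item j
   allocated, probability l_j) or [None] (probability 1 - sum_j l_j), and the
   buyer continues with strategy [k outcome]. *)
Inductive strategy : Type :=
| Stop : strategy
| Buy : vec -> (option 'I_m -> strategy) -> strategy.

Fixpoint valid_strategy (t : strategy) : Prop :=
  match t with
  | Stop => True
  | Buy l k => lottery l /\ forall o, valid_strategy (k o)
  end.

Fixpoint util (v : vec) (p : vec -> R) (S : {set 'I_m}) (t : strategy) : R :=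
  match t with
  | Stop => setval v S
  | Buy l k =>
      - p l + \sum_j l j * util v p (j |: S) (k (Some j))
            + (1 - \sum_j l j) * util v p S (k None)
  end.

Definition buy_many (p : vec -> R) : Prop :=
  forall v, valuation v ->
  forall l0 k, valid_strategy (Buy l0 k) ->
  forall e : R, 0 < e ->
  exists l, lottery l /\ util v p finset.set0 (Buy l0 k) <= lval v l - p l + e.

Definition best_lottery (v : vec) (p : vec -> R) (l : vec) : Prop :=
  lottery l /\ forall l', lottery l' -> lval v l' - p l' <= lval v l - p l.

Definition best_item (v q : vec) (o : option 'I_m) : Prop :=
  match o with
  | Some j => 0 <= v j - q j /\ forall k, v k - q k <= v j - q j
  | None => forall k, v k - q k <= 0
  end.

Definition item_alloc (o : option 'I_m) : vec := fun j => (o == Some j)%:R.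
Definition item_pay (q : vec) (o : option 'I_m) : R :=
  if o is Some j then q j else 0.

Local Open Scope ereal_scope.

(* A randomized mechanism: seller randomness w ~ Q, independent of the buyer
   type V(omega), omega ~ P.  [alloc w v] is the (fractional) allocation and
   [pay w v] the payment of type v.  [mech_ok] collects measurability and the
   ex-ante constraint E_{v,w}[alloc] <= x componentwise; [mech_rev] is the
   expected revenue. *)
Definition mech_ok {dO dW} {O : measurableType dO} {W : measurableType dW}
  (P : probability O R) (V : O -> vec) (Q : probability W R)
  (alloc : W -> vec -> vec) (pay : W -> vec -> R) (x : vec) : Prop :=
  (forall w, measurable_fun setT (fun o => pay w (V o))) /\
  (forall w j, measurable_fun setT (fun o => alloc w (V o) j)) /\
  measurable_fun setT (fun w => \int[P]_o (pay w (V o))%:E : \bar R) /\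
  (forall j, measurable_fun setT (fun w => \int[P]_o (alloc w (V o) j)%:E : \bar R)) /\
  (forall j, \int[Q]_w \int[P]_o (alloc w (V o) j)%:E <= (x j)%:E).

Definition mech_rev {dO dW} {O : measurableType dO} {W : measurableType dW}
  (P : probability O R) (V : O -> vec) (Q : probability W R)
  (pay : W -> vec -> R) : \bar R :=
  \int[Q]_w \int[P]_o (pay w (V o))%:E.

Definition SRev {dO} {O : measurableType dO} (P : probability O R)
  (V : O -> vec) (x : vec) : \bar R :=
  ereal_sup [set r | exists (dW : measure_display) (W : measurableType dW)
      (Q : probability W R) (q : W -> vec) (c : W -> vec -> option 'I_m),
      [/\ forall w j, (0 <= q w j)%R,
          forall w o, best_item (V o) (q w) (c w (V o)),
          mech_ok P V Q (fun w v => item_alloc (c w v))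
                        (fun w v => item_pay (q w) (c w v)) x &
          r = mech_rev P V Q (fun w v => item_pay (q w) (c w v))]].

Definition BuyManyRev {dO} {O : measurableType dO} (P : probability O R)
  (V : O -> vec) (x : vec) : \bar R :=
  ereal_sup [set r | exists (dW : measure_display) (W : measurableType dW)
      (Q : probability W R) (p : W -> vec -> R) (c : W -> vec -> vec),
      [/\ forall w, pricing_fn (p w) /\ buy_many (p w),
          forall w o, best_lottery (V o) (p w) (c w (V o)),
          mech_ok P V Q c (fun w v => p w (c w v)) x &
          r = mech_rev P V Q (fun w v => p w (c w v))]].

End Defs.

(* Main.v *)
(* Let [p] be buy-many, let [q j] be the infimum of [p l / l j], and let [u v]
   be the utility of [v] under [p].  Buying [l] until [j] arrives costs
   [p l / l j], so [v j - q j <= u v], while [q j * l j <= p l].  For costs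
   [c >= 0], the item prices [c + q] leave the buyer at most [u v], and
   [c + q / 2 ^ L] with [2 ^ L >= 2 m] leave her at least
   [u v + p l / 2 - c . l].  From [c + q / 2 ^ k] to [c + q / 2 ^ k.+1] her
   utility grows by at most the profit earned at the second price vector, so
   the profits at [k = 1 .. L] sum to at least [p l / 2 - c . l].  Hence every
   Lagrangian relaxation of the ex-ante constraint is solved, up to [2 L], by a
   single item pricing, and Blackwell approachability turns these pricings into
   a uniform mixture that satisfies the constraint.  Items with [x j = 0] need
   separate care, as there the constraint has no slack: a feasible [p] bounds
   how much they are worth above the other items, so large prices exclude them
   almost surely. *)
Require Import Defs.
From HB Require Import structures.
From mathcomp Require Import all_boot all_order all_algebra.
From mathcomp Require Import all_classical all_reals all_analysis measurable_realfun.
From mathcomp Require Import ring lra zify.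
Import Order.TTheory GRing.Theory Num.Theory.
Local Open Scope ring_scope.

(* Blackwell's argument: weighting by the negative part of the running sum keeps
   the square of its distance to the positive orthant linear in the number of
   steps. *)
Lemma approachability (R : realType) (I : finType) (T : Type) (good : set T)
    (z : T -> I -> R) (B : R) :
  (forall t i, good t -> `|z t i| <= B) ->
  (forall y : I -> R, (forall i, 0 <= y i) ->
    exists t, good t /\ 0 <= \sum_i y i * z t i) ->
  forall e : R, 0 < e -> exists (N : nat) (s : nat -> T),
    (forall k, good (s k)) /\
    forall i, - (e * N.+1%:R) <= \sum_(k < N.+1) z (s k) i.
Proof.
move=> zB orac e e0; pose neg (S : I -> R) i := Num.max 0 (- S i).
have neg0 S i : 0 <= neg S i by rewrite /neg le_max lexx.
have negS S i : - S i <= neg S i by rewrite /neg le_max lexx orbT.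
have /choice[f fP] S : exists t, good t /\ 0 <= \sum_i neg S i * z t i.
  exact: orac.
pose St n := iter n (fun S i => S i + z (f S) i) (fun=> 0).
have StE n i : St n i = \sum_(k < n) z (f (St k)) i.
  by elim: n => [|n IH]; rewrite ?big_ord0// big_ord_recr/= -IH.
pose K : R := #|I|%:R * B ^+ 2.
have inv n : \sum_i neg (St n) i ^+ 2 <= n%:R * K.
  elim: n => [|n IH].
    by rewrite mul0r big1// => i _; rewrite /neg/= oppr0 maxxx expr0n.
  have [gf f0] := fP (St n).
  have step i : neg (St n.+1) i ^+ 2 <=
      neg (St n) i ^+ 2 - 2 * (neg (St n) i * z (f (St n)) i) + B ^+ 2.
    have h1 := neg0 (St n) i; have h2 := negS (St n) i.
    have := zB (f (St n)) i gf; rewrite ler_norml => /andP[h3 h4].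
    (* Either the new negative part vanishes, or it equals the negated new sum; both cases obey the
       same quadratic bound, and the cross terms sum to something nonnegative by the choice of
       [f]. *)
    have : neg (St n.+1) i = 0 \/
           neg (St n.+1) i = - (St n i + z (f (St n)) i) /\ 0 <= neg (St n.+1) i.
      rewrite {1 2}/neg/=; case: (leP 0 (- (St n i + z (f (St n)) i))) => h.
        by right; rewrite neg0.
      by left.
    move: (neg (St n) i) (neg (St n.+1) i) (z _ i) h1 h2 h3 h4.
    move=> a b u h1 h2 h3 h4 hb; have u2 : u ^+ 2 <= B ^+ 2 by nra.
    have := sqr_ge0 (a - u).
    by case: hb => [-> //|[-> b0]]; [lra|have : 0 <= (a - u) + (St n i + u); nra].
  apply: (le_trans (ler_sum _ (fun i _ => step i))).
  rewrite big_split/= sumrB -mulr_sumr sumr_const -[X in _ + X]mulr_natl.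
  rewrite -[n.+1]addn1 natrD mulrDl mul1r -/K.
  lra.
(* With [K < e ^ 2 * (N + 1)], a coordinate below [- e * (N + 1)] would by itself exceed the bound
   [(N + 1) * K] on the squared distance. *)
pose N := Num.truncn (K / e ^+ 2); exists N, (fun k => f (St k)); split=> [k|i].
  by case: (fP (St k)).
rewrite -StE -[leRHS]opprK lerN2; apply: (le_trans (negS _ _)).
rewrite leNgt; apply/negP => lt_neg.
have KN : K < e ^+ 2 * N.+1%:R.
  rewrite mulrC -ltr_pdivrMr ?exprn_gt0//.
  by apply: truncnS_gt.
have := inv N.+1; rewrite (bigD1 i)//=.
have : 0 <= \sum_(j | j != i) neg (St N.+1) j ^+ 2.
  by apply: sumr_ge0 => j _; exact: sqr_ge0.
have eN : 0 < e * N.+1%:R by rewrite mulr_gt0.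
have : N.+1%:R * K < (e * N.+1%:R) ^+ 2.
  have N0 : (0 : R) < N.+1%:R by rewrite ltr0n.
  by rewrite -subr_gt0 in KN; have := mulr_gt0 N0 KN; lra.
have : (e * N.+1%:R) ^+ 2 < neg (St N.+1) i ^+ 2.
  by rewrite ltr_pXn2r // nnegrE ?neg0 1?ltW.
lra.
Qed.

(** * Repeated purchase of one lottery *)

Fixpoint buy_until {R : realType} {m : nat} (l : vec R m) (j : 'I_m) (n : nat) :
    strategy R m :=
  if n is n'.+1 then
    Buy l (fun o => if o == Some j then @Stop R m else buy_until l j n')
  else @Stop R m.

Lemma valid_buy_until {R : realType} {m : nat} (l : vec R m) (j : 'I_m) n :
  lottery l -> valid_strategy (buy_until l j n).
Proof. by move=> ll; elim: n => //= n IH; split=> // o; case: ifP. Qed.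

Lemma setval_ge0 {R : realType} {m : nat} (v : vec R m) S :
  valuation v -> 0 <= setval v S.
Proof.
move=> v0; rewrite /setval; elim/big_ind: _ => [//|a b a0 b0|j _]; last exact: v0.
by rewrite le_max a0.
Qed.

Lemma le_setval {R : realType} {m : nat} (v : vec R m) (S : {set 'I_m}) j :
  j \in S -> v j <= setval v S.
Proof. by move=> jS; apply: le_bigmax_cond. Qed.

(** Item [j] arrives within [n] rounds with probability [1 - (1 - l j) ^ n], and the expected number
    of purchases is that probability divided by [l j]. Other items received on the way only help.
    The set [S] of items already held is general for the sake of the induction. *)
Lemma util_buy_until {R : realType} {m : nat} (v : vec R m) (p : vec R m -> R)
    (l : vec R m) (j : 'I_m) n (S : {set 'I_m}) :
  valuation v -> lottery l -> 0 < l j ->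
  (1 - (1 - l j) ^+ n) * (v j - p l / l j) <= util v p S (buy_until l j n).
Proof.
move=> v0 [l01 lsum] lj; elim: n S => [|n IH] S.
  by rewrite expr0 subrr mul0r /= setval_ge0.
rewrite /=; set y := v j - p l / l j; set A := (1 - l j) ^+ n.
have yE : v j * l j - p l = y * l j by rewrite /y mulrBl divfK// gt_eqF.
have low : \sum_j0 l j0 * (if j0 == j then v j else (1 - A) * y) <=
  \sum_j0 l j0 * util v p (j0 |: S) (if Some j0 == Some j then @Stop R m
                                     else buy_until l j n).
  apply: ler_sum => i _; apply: ler_wpM2l; first by case/andP: (l01 i).
  rewrite (inj_eq Some_inj); case: eqP => [->|_]; last exact: IH.
  by apply: le_setval; rewrite finset.in_setU1 eqxx.
have lowE : \sum_j0 l j0 * (if j0 == j then v j else (1 - A) * y) =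
    l j * v j + (\sum_j0 l j0 - l j) * ((1 - A) * y).
  rewrite (bigD1 j)//= eqxx; congr (_ + _).
  rewrite [in RHS](bigD1 j)//= addrAC subrr add0r mulr_suml.
  by apply: eq_bigr => i /negPf ->.
have last : (1 - \sum_j0 l j0) * ((1 - A) * y) <=
    (1 - \sum_j0 l j0) * util v p S (buy_until l j n).
  by apply: ler_wpM2l; [rewrite subr_ge0|exact: IH].
rewrite exprS -/A; rewrite lowE in low; nra.
Qed.

(** Buying [l1] until [j] arrives is a limit of finite strategies, whose success probability tends
    to 1 because [0 < l1 j]; [buy_many] compares each truncation with a single lottery. *)
Lemma buy_many_item_utility {R : realType} {m : nat} (v : vec R m)
    (p : vec R m -> R) (l l1 : vec R m) (j : 'I_m) :
  buy_many p -> valuation v -> best_lottery v p l ->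
  lottery l1 -> 0 < l1 j -> v j - p l1 / l1 j <= lval v l - p l.
Proof.
move=> bm v0 [ll best] ll1 l1j; set y := v j - _; set u := lval v l - p l.
(* The depth is [n.+1] because [buy_many] speaks only of strategies that start with a purchase. *)
have bound n : (1 - (1 - l1 j) ^+ n.+1) * y <= u.
  apply/ler_addgt0Pr => e e0.
  have [| l2 [ll2]] := bm v v0 l1 (fun o => if o == Some j then @Stop R m
    else buy_until l1 j n) _ e e0.
    exact: (@valid_buy_until _ _ l1 j n.+1).
  have := @util_buy_until _ _ v p l1 j n.+1 finset.set0 v0 ll1 l1j.
  have := best l2 ll2; rewrite /u -/y.
  rewrite [buy_until _ _ n.+1]/=; lra.
have cv : ((1 - (1 - l1 j) ^+ n.+1) * y @[n --> \oo] --> y)%classic.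
  rewrite -[X in (_ --> X)%classic]mul1r; apply: cvgMl.
  rewrite -[X in (_ --> X)%classic]subr0; apply: cvgB; first exact: cvg_cst.
  rewrite (@cvg_shiftS _ (fun n => (1 - l1 j) ^+ n)); apply: cvg_expr.
  case: ll1 => /(_ j)/andP[h0 h1] _.
  rewrite ger0_norm ?subr_ge0//; lra.
by rewrite -(cvg_lim _ cv)//; apply: limr_le; [exact: cvgP cv|exact: nearW].
Qed.

(** * Repeated halving of item prices *)

(** [D] marks the items on sale. The formula for [r] is imposed only on [D], which leaves room for
    prohibitive prices elsewhere; neither the item buyer nor [l] receives anything outside [D]. *)
Lemma price_ladder {R : realType} {m : nat} (D : pred 'I_m) (v c q l : vec R m)
    (r : nat -> vec R m) (o : nat -> option 'I_m) (pay : R) (L : nat) :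
  (forall j, 0 <= c j) -> (forall j, 0 <= q j) ->
  (forall k j, D j -> r k j = c j + q j / 2 ^+ k) ->
  (forall k, best_item v (r k) (o k)) -> (forall k j, o k = Some j -> D j) ->
  lottery l -> 0 <= pay -> (forall j, ~~ D j -> l j = 0) ->
  (forall j, q j * l j <= pay) -> (forall j, v j - q j <= lval v l - pay) ->
  0 <= lval v l - pay -> 2 * m%:R <= 2 ^+ L :> R ->
  pay <= 2 * \sum_j c j * l j
    + 2 * \sum_(k < L) \sum_j q j / 2 ^+ k.+1 * item_alloc R (o k.+1) j.
Proof.
move=> c0 q0 rE best oD [l01 lsum] pay0 lD ql vq u0 mL.
pose prof k := \sum_j q j / 2 ^+ k * item_alloc R (o k) j.
have profE k j : o k = Some j -> prof k = q j / 2 ^+ k.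
  move=> ok; rewrite /prof (bigD1 j)//= ok /item_alloc eqxx mulr1.
  rewrite big1 ?addr0// => i ij; rewrite (_ : _ == _ = false) ?mulr0//.
  by apply/negbTE; apply: contra ij => /eqP[->].
pose U k := if o k is Some j then v j - r k j else 0.
have U0 k : 0 <= U k.
  by rewrite /U; case: (o k) (best k) => [j []|].
have Umax k j : v j - r k j <= U k.
  by rewrite /U; case: (o k) (best k) => [i []|/(_ j)].
(* The item bought on rung [k.+1] costs [q j / 2 ^ k.+1] more on rung [k], which is exactly the
   profit made on it. *)
have step k : U k.+1 - U k <= prof k.+1.
  case E : (o k.+1) => [j|]; last first.
    rewrite {1}/U E /prof E sub0r big1 ?oppr_le0//.
    by move=> j _; rewrite /item_alloc mulr0.
  have Dj := oD _ _ E; have := Umax k j.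
  rewrite (profE _ _ E) {2}/U E !rE// [2 ^+ k.+1]exprS.
  have -> : q j / 2 ^+ k = 2 * (q j / (2 * 2 ^+ k)).
    by field; rewrite expf_neq0// pnatr_eq0.
  lra.
have tele : U L - U 0%N <= \sum_(k < L) prof k.+1.
  elim: L {mL} => [|L IH]; first by rewrite big_ord0 subrr.
  by rewrite big_ord_recr/=; have := step L; lra.
have U0le : U 0%N <= lval v l - pay.
  rewrite /U; case E : (o 0%N) => [j|//].
  rewrite rE ?(oD _ _ E)// expr0 divr1.
  by have := vq j; have := c0 j; lra.
(* On rung [L] the best item is at least as good as one drawn from [l], whose expected markup is at
   most [m * pay / 2 ^ L], hence at most [pay / 2]. *)
have ULge : lval v l - \sum_j c j * l j - pay / 2 <= U L.
  have half : \sum_j q j / 2 ^+ L * l j <= pay / 2.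
    apply: (@le_trans _ _ (\sum_(j < m) pay / 2 ^+ L)).
      apply: ler_sum => j _; rewrite [leLHS]mulrAC.
      rewrite ler_pM2r ?invr_gt0 ?exprn_gt0//.
    rewrite sumr_const card_ord -[X in X <= _]mulr_natl.
    rewrite mulrCA ler_wpM2l //.
    by rewrite ler_pdivrMr ?exprn_gt0// mulrC ler_pdivlMr// mulrC.
  have le1 : \sum_j l j * (v j - c j - q j / 2 ^+ L) <= \sum_j l j * U L.
    apply: ler_sum => j _; have [Dj|nDj] := boolP (D j).
      apply: ler_wpM2l; first by case/andP: (l01 j).
      by have := Umax L j; rewrite rE//; lra.
    by rewrite lD// !mul0r.
  have le2 : \sum_j l j * U L <= U L.
    by rewrite -mulr_suml -[leRHS]mul1r ler_wpM2r.
  have E : \sum_j l j * (v j - c j - q j / 2 ^+ L) =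
      lval v l - \sum_j c j * l j - \sum_j q j / 2 ^+ L * l j.
    rewrite /lval -!sumrB; apply: eq_bigr => j _; ring.
  lra.
rewrite -/(prof _); lra.
Qed.

(** * Measurable choice of a favorite item *)

Definition favorite {R : realType} {m : nat} (r v : vec R m) (j : 'I_m) : bool :=
  (0 <= v j - r j) && [forall k, v k - r k <= v j - r j].

(* Ties are broken towards the smallest index, which keeps the choice measurable. *)
Definition first_best {R : realType} {m : nat} (r v : vec R m) : option 'I_m :=
  [pick j | favorite r v j && [forall k : 'I_m, (k < j)%N ==> ~~ favorite r v k]].

Lemma first_best_SomeP {R : realType} {m : nat} (r v : vec R m) j :
  first_best r v = Some j <->
  favorite r v j && [forall k : 'I_m, (k < j)%N ==> ~~ favorite r v k].
Proof.
rewrite /first_best; case: pickP => [i /andP[fi /forallP mi]|none]; split=> //.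
- by case=> <-; rewrite fi; apply/forallP.
- case/andP=> fj /forallP mj; congr Some; apply/val_inj/eqP.
  rewrite eqn_leq; apply/andP; split; rewrite leqNgt.
  + by apply/negP => /(implyP (mi j)); rewrite fj.
  + by apply/negP => /(implyP (mj i)); rewrite fi.
- by rewrite none.
Qed.

Lemma first_bestP {R : realType} {m : nat} (r v : vec R m) :
  best_item v r (first_best r v).
Proof.
case E : (first_best r v) => [j|].
  move/first_best_SomeP: E => /andP[/andP[h /forallP max] _].
  by split=> // k; apply: max.
move=> k; rewrite leNgt; apply/negP => k0.
have [i _ imax] := @arg_maxP _ _ _ k predT (fun j => v j - r j) isT.
have fi : favorite r v i.
  rewrite /favorite (le_trans (ltW k0) (imax k isT))/=.
  by apply/forallP => j; apply: imax.
have [j fj jmin] := @arg_minnP _ i (favorite r v) (fun j => nat_of_ord j) fi.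
suff : first_best r v = Some j by rewrite E.
apply/first_best_SomeP; rewrite fj; apply/forallP => k'; apply/implyP => lt.
by apply/negP => /jmin; rewrite leqNgt lt.
Qed.

Lemma measurable_first_best {R : realType} {m : nat} {d} {O : measurableType d}
    (V : O -> vec R m) (r : vec R m) (j : 'I_m) :
  (forall j, measurable_fun setT (fun o => V o j)) ->
  measurable [set o | first_best r (V o) = Some j]%classic.
Proof.
move=> mV.
have mle (f g : O -> R) : measurable_fun setT f -> measurable_fun setT g ->
    measurable [set o | f o <= g o]%classic.
  by move=> mf mg; rewrite -[X in measurable X]setTI; exact: measurable_fun_le.
have mVr k : measurable_fun setT (fun o => V o k - r k).
  by apply: measurable_funB => //; exact: measurable_cst.
have mfav k : measurable [set o | favorite r (V o) k]%classic.
  rewrite (_ : mkset _ = [set o | 0 <= V o k - r k]%classic `&`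
     \bigcap_(i in [set: 'I_m]) [set o | V o i - r i <= V o k - r k]%classic)%classic.
    apply: measurableI; first exact: mle.
    by apply: fin_bigcap_measurable => // i _; exact: mle.
  apply/seteqP; split=> o /=; rewrite /favorite.
    by case/andP=> h /forallP hf; split=> // i _; exact: hf.
  by case=> h hf; rewrite h; apply/forallP => i; exact: hf.
rewrite (_ : mkset _ = [set o | favorite r (V o) j]%classic `&`
  \bigcap_(i in [set i : 'I_m | (i < j)%N]) ~` [set o | favorite r (V o) i]%classic)%classic.
  apply: measurableI => //.
  by apply: fin_bigcap_measurable => // i _; exact: measurableC.
apply/seteqP; split=> o /=; rewrite first_best_SomeP.
  by case/andP=> h /forallP hf; split=> // i /= ij; apply/negP/(implyP (hf i)).
case=> h hf; rewrite h; apply/forallP => i; apply/implyP => ij.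
by apply/negP; exact: hf.
Qed.

(** * Sale probabilities of an item pricing *)

Definition sale_prob {R : realType} {m : nat} {d} {O : measurableType d}
    (P : probability O R) (V : O -> vec R m) (r : vec R m) (j : 'I_m) : R :=
  fine (P [set o | first_best r (V o) = Some j]%classic).

Lemma item_payE {R : realType} {m : nat} (r : vec R m) (o : option 'I_m) :
  item_pay r o = \sum_j r j * item_alloc R o j.
Proof.
case: o => [j|] /=; last by rewrite big1// => j _; rewrite /item_alloc mulr0.
rewrite (bigD1 j)//= /item_alloc eqxx mulr1 big1 ?addr0// => i ij.
by rewrite (_ : _ == _ = false) ?mulr0//; apply: contraNF ij => /eqP[->].
Qed.

Section SaleProb.
Context {R : realType} {m : nat} {d : measure_display} {O : measurableType d}.
Context (P : probability O R) (V : O -> vec R m).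
Context (mV : forall j, measurable_fun setT (fun o => V o j)).
Local Open Scope ereal_scope.

Lemma sale_probE r j :
  P [set o | first_best r (V o) = Some j]%classic = (sale_prob P V r j)%:E.
Proof. by rewrite fineK// fin_num_measure//; exact: measurable_first_best. Qed.

Lemma sale_prob_ge0 r j : (0 <= sale_prob P V r j)%R.
Proof. exact: fine_ge0. Qed.

Lemma sale_prob_le1 r j : (sale_prob P V r j <= 1)%R.
Proof.
by rewrite -lee_fin -sale_probE probability_le1//; exact: measurable_first_best.
Qed.

Lemma item_allocE r j :
  (fun o => item_alloc R (first_best r (V o)) j) =
  \1_[set o | first_best r (V o) = Some j]%classic.
Proof.
apply/funext => o; rewrite /item_alloc indicE; congr (_%:R)%R.
by congr nat_of_bool; apply/eqP/idP => [h|]; rewrite inE.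
Qed.

Lemma measurable_item_alloc r j :
  measurable_fun setT (fun o => item_alloc R (first_best r (V o)) j).
Proof. by rewrite item_allocE; apply/measurable_indic/measurable_first_best. Qed.

Lemma measurable_weighted_sales (w : 'I_m -> R) r :
  measurable_fun setT (fun o => \sum_j w j * item_alloc R (first_best r (V o)) j)%R.
Proof.
apply: measurable_sum => j; apply: measurable_funM; first exact: measurable_cst.
exact: measurable_item_alloc.
Qed.

Lemma integral_item_alloc r j :
  \int[P]_o (item_alloc R (first_best r (V o)) j)%:E = (sale_prob P V r j)%:E.
Proof.
rewrite -sale_probE -[in RHS](setIT [set o | _ = _]%classic).
rewrite -integral_indic//; last exact: measurable_first_best.
by apply: eq_integral => o _; rewrite -item_allocE.
Qed.

Lemma integral_weighted_sales (w : 'I_m -> R) r :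
  (forall j, 0 <= w j)%R ->
  \int[P]_o (\sum_j w j * item_alloc R (first_best r (V o)) j)%:E =
  (\sum_j w j * sale_prob P V r j)%:E.
Proof.
move=> w0; under eq_integral do rewrite -sumEFin.
rewrite ge0_integral_sum//.
- rewrite -sumEFin; apply: eq_bigr => j _.
  under eq_integral do rewrite EFinM.
  rewrite ge0_integralZl ?lee_fin//.
  + by rewrite integral_item_alloc EFinM.
  + by apply/measurable_EFinP; exact: measurable_item_alloc.
  + by move=> o _; rewrite lee_fin ler0n.
- move=> j; apply/measurable_EFinP/measurable_funM => //.
  exact: measurable_item_alloc.
- by move=> j o _; rewrite lee_fin mulr_ge0// ler0n.
Qed.

End SaleProb.

(** * Uniform mixtures of finitely many item pricings *)

Section UniformNat.
Context {R : realType} (N : nat).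

Let atoms := msum (fun k : nat => (\d_k : measure nat R)) N.+1.

Definition uniform_nat : set nat -> \bar R := mscale (N.+1%:R^-1 : R)%:nng atoms.

HB.instance Definition _ := Measure.on uniform_nat.

Let uniform_nat_setT : uniform_nat setT = 1%E.
Proof.
rewrite /uniform_nat /mscale/= /atoms /msum/=.
under eq_bigr do rewrite diracT.
by rewrite sumEFin -EFinM sumr_const card_ord -[(1 *+ _)%R]/N.+1%:R mulVf.
Qed.

HB.instance Definition _ :=
  Measure_isProbability.Build _ _ _ uniform_nat uniform_nat_setT.

Lemma integral_uniform_nat (f : nat -> R) : (forall k, 0 <= f k)%R ->
  (\int[uniform_nat]_k (f k)%:E = ((\sum_(k < N.+1) f k) / N.+1%:R)%:E)%E.
Proof.
move=> f0; have mf : measurable_fun setT (EFin \o f) by [].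
rewrite ge0_integral_mscale//; last by move=> k _; rewrite lee_fin.
rewrite ge0_integral_measure_sum//; last by move=> k _; rewrite lee_fin.
under eq_bigr do rewrite integral_dirac// diracT mul1e.
by rewrite sumEFin -EFinM mulrC.
Qed.

End UniformNat.

Lemma SRev_ge_average {R : realType} {m : nat} {d : measure_display}
    {O : measurableType d} (P : probability O R) (V : O -> vec R m) (x : vec R m)
    (N : nat) (s : nat -> vec R m) :
  (forall j, measurable_fun setT (fun o => V o j)) ->
  (forall k j, 0 <= s k j) ->
  (forall j, \sum_(k < N.+1) sale_prob P V (s k) j <= N.+1%:R * x j) ->
  (((\sum_(k < N.+1) \sum_j s k j * sale_prob P V (s k) j) / N.+1%:R)%:E
     <= SRev P V x)%E.
Proof.
move=> mV s0 sx; apply: ereal_sup_ubound.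
have payI k : (\int[P]_o (item_pay (s k) (first_best (s k) (V o)))%:E =
    (\sum_j s k j * sale_prob P V (s k) j)%:E)%E.
  by under eq_integral do rewrite item_payE; exact: integral_weighted_sales.
(* The seller draws [k <= N] uniformly and posts [s k]; every function on [nat] is measurable. *)
exists _, nat, (uniform_nat N : probability nat R), s, (fun k v => first_best (s k) v).
split=> //.
- by move=> k o; exact: first_bestP.
- split; [|split; [|split; [|split]]] => //.
  + move=> k; rewrite (_ : (fun o => _) = fun o =>
      \sum_j s k j * item_alloc R (first_best (s k) (V o)) j).
      exact: measurable_weighted_sales.
    by apply/funext => o; exact: item_payE.
  + by move=> k j; exact: measurable_item_alloc.
  + move=> j; under eq_integral do rewrite integral_item_alloc//.
    rewrite integral_uniform_nat; last by move=> k; exact: sale_prob_ge0.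
    by rewrite lee_fin ler_pdivrMr// mulrC.
- rewrite /mech_rev; under eq_integral do rewrite payI.
  rewrite integral_uniform_nat// => k.
  by apply: sumr_ge0 => j _; rewrite mulr_ge0// sale_prob_ge0.
Qed.

(** * Item prices implied by a buy-many pricing *)

Lemma lottery_item {R : realType} {m : nat} (j : 'I_m) :
  lottery (item_alloc R (Some j)).
Proof.
split=> [i|]; first by rewrite /item_alloc ler0n lern1 leq_b1.
rewrite (bigD1 j)//= big1 ?addr0 /item_alloc ?eqxx// => i ij.
by rewrite (inj_eq Some_inj) eq_sym (negPf ij).
Qed.

Lemma lval_item {R : realType} {m : nat} (v : vec R m) (j : 'I_m) :
  lval v (item_alloc R (Some j)) = v j.
Proof. by rewrite /lval -item_payE. Qed.

Lemma lottery0 {R : realType} {m : nat} : lottery (@lot0 R m).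
Proof. by split=> [i|]; rewrite /lot0 ?lexx ?ler01// big1. Qed.

Lemma best_lottery_ge0 {R : realType} {m : nat} (v l : vec R m) (p : vec R m -> R) :
  pricing_fn p -> best_lottery v p l -> 0 <= lval v l - p l.
Proof.
move=> [_ p0] [_ /(_ _ lottery0)]; rewrite p0 subr0; apply: le_trans.
by rewrite /lval big1// => j _; rewrite /lot0 mulr0.
Qed.

(* Item [j] is priced at the infimum of the expected cost [p l / l j] of
   buying [l] until [j] is received. *)
Lemma implied_item_prices {R : realType} {m : nat} (p : vec R m -> R) :
  pricing_fn p -> buy_many p -> exists q : vec R m,
  [/\ forall j, 0 <= q j,
      forall l j, lottery l -> q j * l j <= p l &
      forall v l, valuation v -> best_lottery v p l ->
        forall j, v j - q j <= lval v l - p l].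
Proof.
move=> [p0 pz] bm.
pose E (j : 'I_m) := [set r : R | exists l, [/\ lottery l, 0 < l j & r = p l / l j]]%classic.
have Enz j : (E j !=set0)%classic.
  exists (p (item_alloc R (Some j)) / item_alloc R (Some j) j).
  exists (item_alloc R (Some j)); split=> //; first exact: lottery_item.
  by rewrite /item_alloc eqxx.
have Elb j : lbound (E j) 0.
  by move=> _ [l [ll lj ->]]; rewrite divr_ge0 ?p0// ltW.
exists (fun j => inf (E j)); split=> [j|l j ll|v l v0 bl j].
- exact: lb_le_inf.
- have [lj|] := ltP 0 (l j).
    rewrite -ler_pdivlMr//; apply: ge_inf; first by exists 0.
    by exists l.
  have := ll.1 j => /andP[h _] h'; rewrite (_ : l j = 0) ?mulr0 ?p0//.
  by apply/le_anti; rewrite h h'.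
- rewrite lerBlDr -lerBlDl; apply: lb_le_inf => // _ [l1 [ll1 l1j ->]].
  by have := buy_many_item_utility _ _ _ _ _ bm v0 bl ll1 l1j; lra.
Qed.

(* Items with [x j = 0] must not be sold, so they are priced out of reach. *)
Definition guarded {R : realType} {m : nat} (x : vec R m) (K : R) (b : vec R m) :
    vec R m :=
  fun j => if x j == 0 then K + 1 + \sum_k b k else b j.

Lemma guarded_ge0 {R : realType} {m : nat} (x : vec R m) K (b : vec R m) j :
  0 <= K -> (forall j, 0 <= b j) -> 0 <= guarded x K b j.
Proof. by move=> K0 b0; rewrite /guarded; case: ifP => // _; rewrite !addr_ge0 ?sumr_ge0. Qed.

(** The guard price exceeds both [K] and [K + b k] for each [k]. So either [j] yields negative
    utility, or an allowed item worth at most [K] less yields strictly more. *)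
Lemma guarded_unsold {R : realType} {m : nat} (x v : vec R m) K (b : vec R m) j :
  (forall j, 0 <= b j) ->
  v j <= K \/ (exists k, x k != 0 /\ v j <= K + v k) ->
  first_best (guarded x K b) v = Some j -> x j != 0.
Proof.
move=> b0 vb; have := first_bestP (guarded x K b) v => /[swap] E; rewrite E.
case=> h max; apply/eqP => xj; move: h max; rewrite {1 3}/guarded xj eqxx => h max.
have S0 : 0 <= \sum_k b k by exact: sumr_ge0.
case: vb => [|[k [xk vk]]]; first by lra.
have := max k; rewrite /guarded (negPf xk).
have : b k <= \sum_k b k by rewrite (bigD1 k)//= lerDl sumr_ge0.
by lra.
Qed.

Lemma tail_prob_le {R : realType} {d} {O : measurableType d} (P : probability O R)
    (f : O -> R) (e : R) : measurable_fun setT f -> 0 < e ->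
  (\forall n \near \oo%classic, (P [set o | (n%:R <= f o)%R]%classic <= e%:E)%E).
Proof.
move=> mf e0; pose F n := [set o | n%:R <= f o]%classic.
have mF n : measurable (F n).
  by rewrite -[F n]setTI; apply: measurable_fun_le => //; exact: measurable_cst.
have F0 : (\bigcap_n F n)%classic = set0.
  apply/seteqP; split=> // o /(_ (Num.truncn (f o)).+1 I).
  by rewrite /F/= leNgt truncnS_gt.
have : ((P \o F) x @[x --> \oo] --> P (\bigcap_n F n))%classic.
  apply: nonincreasing_cvg_mu => //.
  - by rewrite (le_lt_trans (probability_le1 P (mF 0%N)))// ltry.
  - by rewrite F0.
  - move=> n k nk; apply/subsetPset => o; rewrite /F/=; apply: le_trans.
    by rewrite ler_nat.
rewrite F0 measure0 => /fine_cvgP[_ cv].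
have cv' := cvgr_lt _ cv _ e0.
near=> n; rewrite -[P _]fineK ?fin_num_measure//; last exact: mF.
rewrite lee_fin ltW//; near: n; exact: cv'.
Unshelve. all: end_near.
Qed.

(** * Comparison of a fixed buy-many mechanism with item pricings *)

Section Mechanism.
Context {R : realType} {m : nat} {dO dW : measure_display}.
Context {O : measurableType dO} {W : measurableType dW}.
Context (P : probability O R) (V : O -> vec R m) (x : vec R m).
Context (V0 : forall o, valuation (V o)).
Context (mV : forall j, measurable_fun setT (fun o => V o j)).
Context (x01 : lottery x).
Context (Q : probability W R) (p : W -> vec R m -> R) (c : W -> vec R m -> vec R m).
Context (pP : forall w, pricing_fn (p w) /\ buy_many (p w)).
Context (cP : forall w o, best_lottery (V o) (p w) (c w (V o))).
Context (okP : mech_ok P V Q c (fun w v => p w (c w v)) x).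

Let x0 j : 0 <= x j. Proof. by case/andP: (x01.1 j). Qed.
Let c0 w o j : 0 <= c w (V o) j. Proof. by case/andP: ((cP w o).1.1 j). Qed.
Let p0 w o : 0 <= p w (c w (V o)).
Proof. exact: (pP w).1.1 (cP w o).1. Qed.

Let mc w j : measurable_fun setT (fun o => c w (V o) j).
Proof. by case: okP => _ [/(_ w j)]. Qed.
Let mp w : measurable_fun setT (fun o => p w (c w (V o))).
Proof. by case: okP => /(_ w). Qed.

Let alloc w j := (\int[P]_o (c w (V o) j)%:E)%E.

Let malloc j : measurable_fun setT (fun w => alloc w j : \bar R).
Proof. by case: okP => _ [_ [_ [/(_ j)]]]. Qed.

Let alloc_ge0 w j : (0 <= alloc w j)%E.
Proof. by apply: integral_ge0 => o _; rewrite lee_fin. Qed.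

Local Notation excluded_values_le K :=
  (\forall o \ae P, forall j, x j = 0 ->
    V o j <= K \/ (exists k, x k != 0 /\ V o j <= K + V o k)).

(** A nonnegative allocation whose double integral is at most [x j = 0] vanishes for almost every
    pricing and then for almost every type. *)
Lemma ae_unallocated :
  \forall w \ae Q, \forall o \ae P, forall j, x j = 0 -> c w (V o) j = 0.
Proof.
have : \forall w \ae Q, forall j, x j = 0 -> alloc w j = 0%E.
  apply: filter_forall => j; have [xj|xj] := eqVneq (x j) 0; last first.
    by apply: nearW => w /eqP; rewrite (negPf xj).
  have : (\int[Q]_w `|alloc w j|)%E = 0%E.
    apply/le_anti/andP; split; last exact: integral_ge0.
    under eq_integral do rewrite gee0_abs//.
    by case: okP => _ [_ [_ [_ /(_ j)]]]; rewrite xj.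
  move/ae_eq_integral_abs => /(_ measurableT (malloc j)).
  by apply: filterS => w /(_ I).
apply: filterS => w aw; apply: filter_forall => j.
have [xj|xj] := eqVneq (x j) 0; last first.
  by apply: nearW => o /eqP; rewrite (negPf xj).
have mcE : measurable_fun setT (fun o => (c w (V o) j)%:E) by exact/measurable_EFinP.
have : (\int[P]_o `|(c w (V o) j)%:E|)%E = 0%E.
  by under eq_integral do rewrite gee0_abs ?lee_fin//; exact: aw.
move/ae_eq_integral_abs => /(_ measurableT mcE).
by apply: filterS => o /(_ I)[].
Qed.

(** One pricing [w] outside the null set yields a bound for almost all types. Each type could buy an
    excluded item [j] alone, at a price independent of the type; if [j] were worth far more than
    zero and than every allowed item, this would beat the chosen lottery, which allocates allowed
    items only. *)
Lemma ae_value_bound : exists2 K : R, 0 <= K & excluded_values_le K.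
Proof.
have pf : ProperFilter (almost_everywhere Q).
  by apply: ae_properfilter_algebraOfSetsType; rewrite [ltRHS]probability_setT.
have [w aw] := filter_ex ae_unallocated.
have pi0 j : 0 <= p w (item_alloc R (Some j)).
  by apply: (pP w).1.1; exact: lottery_item.
exists (1 + \sum_j p w (item_alloc R (Some j))).
  by rewrite addr_ge0// sumr_ge0.
apply: filterS aw => o ao j xj.
have pj : p w (item_alloc R (Some j)) <= \sum_j p w (item_alloc R (Some j)).
  by rewrite [leRHS](bigD1 j)//= lerDl sumr_ge0.
set K := \sum_j _ in pj *.
have [[l01 lsum] best] := cP w o.
have := best _ (lottery_item j); rewrite lval_item => bj.
have [|] := leP (V o j) (1 + K); first by left.
move=> Kj; right; apply: contrapT => no.
have small k : V o k * c w (V o) k <= (V o j - 1 - K) * c w (V o) k.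
  have [xk|xk] := eqVneq (x k) 0; first by rewrite ao// !mulr0.
  apply: ler_wpM2r => //; rewrite leNgt; apply/negP => h.
  by apply: no; exists k; split=> //; lra.
have : lval (V o) (c w (V o)) <= V o j - 1 - K.
  apply: le_trans (ler_sum _ (fun k _ => small k)) _.
  by rewrite -mulr_sumr -[leRHS]mulr1 ler_wpM2l//; lra.
by have := p0 w o; lra.
Qed.

Lemma sale_prob_guarded K (b : vec R m) j :
  excluded_values_le K ->
  (forall j, 0 <= b j) -> x j = 0 -> sale_prob P V (guarded x K b) j = 0.
Proof.
move=> vb b0 xj; rewrite /sale_prob measure_negligible//.
  exact: measurable_first_best.
apply: negligibleS vb => o /= E /(_ j xj) h.
by have := guarded_unsold _ _ _ _ _ b0 h E; rewrite xj eqxx.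
Qed.

(** The price [n] sells an allowed item only to types valuing it at [n] or more, an event of
    vanishing probability as [n] grows. The factor 1/2 provides slack in the constraint. *)
Lemma exists_rare_sales K :
  excluded_values_le K ->
  exists2 b : vec R m, forall j, 0 <= b j &
    forall j, sale_prob P V (guarded x K b) j <= x j / 2.
Proof.
move=> vb.
have : \forall n \near \oo%classic, forall j,
    x j != 0 -> (P [set o | (n%:R <= V o j)%R]%classic <= (x j / 2)%:E)%E.
  apply: filter_forall => j; have [xj|xj] := eqVneq (x j) 0.
    by apply: nearW => n; rewrite xj.
  have xj2 : 0 < x j / 2 by rewrite divr_gt0// lt_neqAle eq_sym xj x0.
  by apply: filterS (tail_prob_le P _ _ (mV j) xj2) => n.
case/filter_ex => n hn; exists (fun=> n%:R) => // j.
have [xj|xj] := eqVneq (x j) 0; first by rewrite sale_prob_guarded// xj mul0r.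
rewrite -lee_fin -sale_probE//; apply: le_trans (hn j xj).
apply: le_measure; rewrite ?inE; first exact: measurable_first_best.
  rewrite -[X in measurable X]setTI.
  by apply: measurable_fun_le => //; exact: measurable_cst.
move=> o /= E; have := first_bestP (guarded x K (fun=> n%:R)) (V o).
by rewrite E /= /guarded (negPf xj) subr_ge0 => -[].
Qed.

(* Weak duality: [cost] prices the ex-ante constraint, and selling at
   [cost + q / 2 ^ k] for some [k] earns a [1 / (2 L)] share of the revenue. *)
Lemma exists_lagrangian_pricing (K : R) (L : nat) (t : R) (cost : vec R m) :
  0 <= K ->
  excluded_values_le K ->
  (0 < L)%N -> 2 * m%:R <= 2 ^+ L :> R -> (forall j, 0 <= cost j) ->
  ((2 * L%:R * t)%:E < mech_rev P V Q (fun w v => p w (c w v)))%E ->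
  exists2 b : vec R m, forall j, 0 <= b j &
    t + \sum_j cost j * sale_prob P V (guarded x K b) j <=
    \sum_j cost j * x j +
    \sum_j guarded x K b j * sale_prob P V (guarded x K b) j.
Proof.
move=> K0 vb L0 mL cost0 tlt; apply: contrapT => none.
(* If every guarded pricing falls short, [S] exceeds the revenue minus the cost of sales of each of
   them. *)
pose S := t - \sum_j cost j * x j.
pose rung (q : vec R m) k : vec R m := fun j => cost j + q j / 2 ^+ k.
have rung0 (q : vec R m) k j : (forall j, 0 <= q j) -> 0 <= rung q k j.
  by move=> q0; rewrite addr_ge0// divr_ge0// exprn_ge0.
pose sale q k := sale_prob P V (guarded x K (rung q k)).
have profitS (q : vec R m) k : (forall j, 0 <= q j) ->
    \sum_j q j / 2 ^+ k * sale q k j <= S.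
  move=> q0; rewrite leNgt; apply/negP => lt; apply: none.
  exists (rung q k) => [j|]; first exact: rung0.
  have -> : \sum_j guarded x K (rung q k) j * sale q k j =
      \sum_j cost j * sale q k j + \sum_j q j / 2 ^+ k * sale q k j.
    rewrite -big_split/=; apply: eq_bigr => j _; rewrite -mulrDl.
    have [xj|xj] := eqVneq (x j) 0.
      by rewrite /sale sale_prob_guarded ?mulr0// => i; exact: rung0.
    by rewrite /guarded (negPf xj).
  by rewrite /S in lt; rewrite -/(sale q k); lra.
have S0 : 0 <= S.
  by apply: le_trans (profitS (fun=> 0) 0%N _) => //; rewrite big1// => j _; rewrite !mul0r.
(* The implied prices [q] vary with [w], but the right-hand side does not mention them, because
   [profitS] is uniform in [q]. *)
have bound : \forall w \ae Q, (\int[P]_o (p w (c w (V o)))%:E <=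
    \sum_j (2 * cost j)%:E * alloc w j + (2 * L%:R * S)%:E)%E.
  apply: filterS ae_unallocated => w aw.
  have [q [q0 qp vq]] := implied_item_prices _ (pP w).1 (pP w).2.
  pose r k := guarded x K (rung q k).
  pose f1 o := \sum_j (2 * cost j) * c w (V o) j.
  pose f2 k o := \sum_j (2 * (q j / 2 ^+ k.+1)) *
                   item_alloc R (first_best (r k.+1) (V o)) j.
  have w0 k j : 0 <= 2 * (q j / 2 ^+ k) by rewrite mulr_ge0// divr_ge0// exprn_ge0.
  have f10 o : 0 <= f1 o by apply: sumr_ge0 => j _; rewrite !mulr_ge0.
  have f20 k o : 0 <= f2 k o.
    by apply: sumr_ge0 => j _; rewrite mulr_ge0// ler0n.
  have mf1 : measurable_fun setT f1.
    apply: measurable_sum => j; apply: measurable_funM => //; exact: measurable_cst.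
  have mf2 k : measurable_fun setT (f2 k) by exact: measurable_weighted_sales.
  have If1 : (\int[P]_o (f1 o)%:E = \sum_j (2 * cost j)%:E * alloc w j)%E.
    under eq_integral do rewrite -sumEFin.
    rewrite ge0_integral_sum//.
    - apply: eq_bigr => j _; under eq_integral do rewrite EFinM.
      rewrite ge0_integralZl ?lee_fin ?mulr_ge0//.
        by apply/measurable_EFinP.
      by move=> o _; rewrite lee_fin.
    - move=> j; apply/measurable_EFinP/measurable_funM => //; exact: measurable_cst.
    - by move=> j o _; rewrite lee_fin !mulr_ge0.
  have If2 : (\int[P]_o (\sum_(k < L) f2 k o)%:E <= (2 * L%:R * S)%:E)%E.
    under eq_integral do rewrite -sumEFin.
    rewrite ge0_integral_sum//.
    - under eq_bigr do rewrite integral_weighted_sales//.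
      rewrite sumEFin lee_fin.
      apply: (@le_trans _ _ (\sum_(k < L) 2 * S)).
        apply: ler_sum => k _; under eq_bigr do rewrite -mulrA.
        by rewrite -mulr_sumr ler_wpM2l//; exact: profitS.
      by rewrite sumr_const card_ord -[leLHS]mulr_natl mulrCA mulrA.
    - by move=> k; apply/measurable_EFinP.
    - by move=> k o _; rewrite lee_fin.
  apply: (@le_trans _ _ (\int[P]_o (f1 o + \sum_(k < L) f2 k o)%:E)%E); last first.
    under eq_integral do rewrite EFinD.
    rewrite ge0_integralD//.
    - by rewrite If1 leeD2l.
    - by move=> o _; rewrite lee_fin.
    - by apply/measurable_EFinP.
    - by move=> o _; rewrite lee_fin sumr_ge0.
    - by apply/measurable_EFinP; exact: measurable_sum.
  apply: ae_ge0_le_integral => //.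
  - by move=> o _; rewrite lee_fin.
  - by apply/measurable_EFinP.
  - by move=> o _; rewrite lee_fin addr_ge0// sumr_ge0.
  - by apply/measurable_EFinP/measurable_funD => //; exact: measurable_sum.
  apply: filterS2 aw vb => o ao vbo _; rewrite lee_fin.
  have l_lot := (cP w o).1.
  apply: le_trans (@price_ladder R m (fun j => x j != 0) (V o) cost q
    (c w (V o)) r (fun k => first_best (r k) (V o)) (p w (c w (V o))) L
    cost0 q0 _ (fun k => first_bestP _ _) _ (cP w o).1 (p0 w o) _ _
    (vq _ _ (V0 o) (cP w o)) (best_lottery_ge0 _ _ _ (pP w).1 (cP w o)) mL) _.
  - by move=> k j xj; rewrite /r /guarded (negPf xj).
  - move=> k j E; have [xj|//] := eqVneq (x j) 0.
    have := guarded_unsold _ _ _ _ _ _ (vbo j xj) E.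
    by rewrite xj eqxx; apply=> i; exact: rung0.
  - by move=> j; rewrite negbK => /eqP; exact: ao.
  - by move=> j; apply: qp; exact: (cP w o).1.
  rewrite /f1 /f2 !mulr_sumr lerD//.
    by apply: ler_sum => j _; rewrite mulrA.
  apply: ler_sum => k _; rewrite mulr_sumr.
  by apply: ler_sum => j _; rewrite mulrA.
have mbound j : measurable_fun setT (fun w => (2 * cost j)%:E * alloc w j)%E.
  exact: measurable_funeM.
have bound0 w : (0 <= \sum_j (2 * cost j)%:E * alloc w j)%E.
  by apply: sume_ge0 => j _; rewrite mule_ge0// lee_fin mulr_ge0.
have LS0 : (0 <= (2 * L%:R * S)%:E)%E by rewrite lee_fin !mulr_ge0.
(* With [X] the cost of [x], integrating over [w] gives at most [2 * X + 2 * L * (t - X)], which is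
   at most [2 * L * t] because [1 <= L]. *)
have : (mech_rev P V Q (fun w v => p w (c w v)) <= (2 * L%:R * t)%:E)%E.
  apply: (@le_trans _ _ (\int[Q]_w (\sum_j (2 * cost j)%:E * alloc w j +
                                   (2 * L%:R * S)%:E))%E).
    apply: ae_ge0_le_integral => //.
    - by move=> w _; apply: integral_ge0 => o _; rewrite lee_fin.
    - by case: okP => _ [_ []].
    - by move=> w _; rewrite adde_ge0.
    - by apply: emeasurable_funD => //; exact: emeasurable_sum.
    - by apply: filterS bound.
  rewrite ge0_integralD//; last exact: emeasurable_sum.
  rewrite ge0_integral_sum//; last first.
    by move=> j w _; rewrite mule_ge0// lee_fin mulr_ge0.
  rewrite integral_cst// [X in (_ * X)%E]probability_setT mule1.
  apply: (@le_trans _ _ ((\sum_j 2 * cost j * x j)%:E + (2 * L%:R * S)%:E)%E).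
    rewrite leeD2r// -sumEFin; apply: lee_sum => j _.
    rewrite ge0_integralZl ?lee_fin ?mulr_ge0// [leRHS]EFinM.
    apply: lee_wpmul2l; first by rewrite lee_fin mulr_ge0.
    by case: okP => _ [_ [_ [_ /(_ j)]]].
  rewrite -EFinD lee_fin; under eq_bigr do rewrite -mulrA.
  rewrite -mulr_sumr /S.
  have : 0 <= \sum_j cost j * x j by apply: sumr_ge0 => j _; rewrite mulr_ge0.
  have : 1 <= L%:R :> R by rewrite ler1n.
  set X := \sum_j _; set l := L%:R; nra.
by rewrite leNgt tlt.
Qed.

(** Blackwell's payoff has one coordinate for revenue, with target [t / 2], and one per item for the
    constraint, with target [3 / 4 * x j]. The gaps to [t / 4] and [x j] absorb the approximation
    error. *)
Lemma SRev_ge_quarter (K : R) (L : nat) (t : R) :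
  0 <= K ->
  excluded_values_le K ->
  (0 < L)%N -> 2 * m%:R <= 2 ^+ L :> R -> 0 < t ->
  ((2 * L%:R * t)%:E < mech_rev P V Q (fun w v => p w (c w v)))%E ->
  ((t / 4)%:E <= SRev P V x)%E.
Proof.
move=> K0 vb L0 mL t0 tlt.
pose a b := sale_prob P V (guarded x K b).
pose rev b := \sum_j guarded x K b j * a b j.
have a0 b j : 0 <= a b j by exact: sale_prob_ge0.
have rev0 b : (forall j, 0 <= b j) -> 0 <= rev b.
  by move=> b0; apply: sumr_ge0 => j _; rewrite mulr_ge0// guarded_ge0.
have [bs bs0 bsx] := exists_rare_sales K vb.
pose d := \big[Num.min/1]_(j | x j != 0) x j.
have d0 : 0 < d.
  by apply: lt_bigmin => // j xj; rewrite lt_neqAle eq_sym xj x0.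
have dx j : x j != 0 -> d <= x j by move=> xj; exact: bigmin_le_cond.
(* Truncating revenue at [M] keeps the payoffs bounded; the term [2 * t / d] covers the largest cost
   of sales that can occur in the oracle below. *)
pose M := t / 2 + 2 * t / d.
have td0 : 0 <= 2 * t / d by rewrite divr_ge0 ?mulr_ge0// ltW.
pose z b (i : 'I_m.+1) : R :=
  if unlift ord0 i is Some j then 3 / 4 * x j - a b j
  else Num.min (rev b) M - t / 2.
have min0 b : (forall j, 0 <= b j) -> 0 <= Num.min (rev b) M.
  by move=> b0; rewrite le_min rev0//= addr_ge0// divr_ge0// ltW.
have zB b i : (forall j, 0 <= b j) -> `|z b i| <= M + t + 1.
  move=> b0; rewrite ler_norml /z /M; case: unliftP => [j _|_].
    have := x0 j; have := a0 b j; have := sale_prob_le1 P V mV (guarded x K b) j.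
    by have /andP[_] := x01.1 j; rewrite -/(a b j); lra.
  have : Num.min (rev b) M <= M by rewrite ge_min lexx orbT.
  by have := min0 b b0; rewrite /M; lra.
have oracle (y : 'I_m.+1 -> R) : (forall i, 0 <= y i) ->
    exists b, (forall j, 0 <= b j) /\ 0 <= \sum_i y i * z b i.
  move=> y0.
  have zE b : \sum_i y i * z b i = y ord0 * (Num.min (rev b) M - t / 2) +
      \sum_j y (lift ord0 j) * (3 / 4 * x j - a b j).
    rewrite big_ord_recl {1}/z unlift_none; congr (_ + _).
    by apply: eq_bigr => j _; rewrite /z liftK.
  set c' := fun j => y (lift ord0 j).
  have c'0 j : 0 <= c' j by exact: y0.
  have cx0 : 0 <= \sum_j c' j * x j by apply: sumr_ge0 => j _; rewrite mulr_ge0.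
  (* When the constraint weights dominate, rare sales suffice: the slack [x j / 4] per item
     outweighs the revenue loss of at most [t / 2]. *)
  have [le|lt] := leP (2 * y ord0 * t) (\sum_j c' j * x j).
    exists bs; split=> //; rewrite zE.
    have : y ord0 * (- (t / 2)) <= y ord0 * (Num.min (rev bs) M - t / 2).
      by apply: ler_wpM2l => //; have := min0 _ bs0; lra.
    have : (\sum_j c' j * x j) / 4 <= \sum_j c' j * (3 / 4 * x j - a bs j).
      rewrite mulr_suml; apply: ler_sum => j _; rewrite -mulrA.
      by apply: ler_wpM2l => //; have := bsx j; rewrite -/(a bs j); lra.
    by lra.
  have y00 : 0 < y ord0.
    by rewrite lt_neqAle y0 andbT eq_sym; apply/eqP => E; rewrite E in lt; lra.
  pose cost j := c' j / y ord0.
  have cost0 j : 0 <= cost j by rewrite divr_ge0.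
  have costx : \sum_j cost j * x j < 2 * t.
    under eq_bigr do rewrite /cost mulrAC.
    by rewrite -mulr_suml ltr_pdivrMr//; lra.
  (* Otherwise the weights, normalized by that of revenue, act as costs with [cost . x < 2 * t], so
     replacing [x] by [3 / 4 * x] loses less than [t / 2]. *)
  have [b b0 lag] := exists_lagrangian_pricing K L t cost K0 vb L0 mL cost0 tlt.
  exists b; split=> //; rewrite zE.
  have -> : \sum_j c' j * (3 / 4 * x j - a b j) = y ord0 *
      (3 / 4 * (\sum_j cost j * x j) - \sum_j cost j * a b j).
    rewrite mulrBr !mulr_sumr -sumrB; apply: eq_bigr => j _.
    by rewrite /cost; field; rewrite gt_eqF.
  rewrite -mulrDr mulr_ge0//; rewrite -/(rev b) in lag.
  have [rM|Mr] := leP (rev b) M.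
    by rewrite /a; lra.
  have : \sum_j cost j * a b j <= (\sum_j cost j * x j) / d.
    rewrite mulr_suml; apply: ler_sum => j _; rewrite -mulrA ler_wpM2l//.
    have [xj|xj] := eqVneq (x j) 0; first by rewrite /a sale_prob_guarded// xj mul0r.
    rewrite (le_trans (sale_prob_le1 P V mV _ _))// ler_pdivlMr// mul1r.
    exact: dx.
  have : (\sum_j cost j * x j) / d <= 2 * t / d.
    by rewrite ler_pM2r ?invr_gt0// ltW.
  have : 0 <= \sum_j cost j * x j by apply: sumr_ge0 => j _; rewrite mulr_ge0.
  by rewrite /M; lra.
(* The error [t / 4] leaves revenue [t / 4], and [d / 4 <= x j / 4] lifts [3 / 4 * x j] to at most
   [x j] for each allowed item. *)
pose e := Num.min (t / 4) (d / 4).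
have e0 : 0 < e by rewrite lt_min !divr_gt0.
have [et ed] : e <= t / 4 /\ e <= d / 4.
  by rewrite /e; split; rewrite ge_min lexx ?orbT.
have [N [s [s0 sz]]] := @approachability _ _ _
  [set b : vec R m | forall j, 0 <= b j]%classic z _ zB oracle e e0.
have N0 : (0 : R) < N.+1%:R by rewrite ltr0n.
have NE (u : R) : N.+1%:R * u = \sum_(k < N.+1) u.
  by rewrite sumr_const card_ord mulr_natl.
apply: le_trans (SRev_ge_average P V x N (fun k => guarded x K (s k)) mV _ _).
- rewrite lee_fin ler_pdivlMr//.
  have : \sum_(k < N.+1) z (s k) ord0 <=
      \sum_(k < N.+1) rev (s k) - N.+1%:R * (t / 2).
    rewrite NE -sumrB.
    apply: ler_sum => k _; rewrite /z unlift_none lerD2r.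
    by rewrite ge_min lexx.
  have := sz ord0; rewrite /rev /a.
  have : e * N.+1%:R <= t / 4 * N.+1%:R by rewrite ler_wpM2r// ltW.
  by lra.
- by move=> k j; apply: guarded_ge0 => // i; exact: s0.
- move=> j; have [xj|xj] := eqVneq (x j) 0.
    rewrite xj mulr0 big1// => k _; rewrite sale_prob_guarded//; exact: s0.
  have : \sum_(k < N.+1) z (s k) (lift ord0 j) =
      N.+1%:R * (3 / 4 * x j) - \sum_(k < N.+1) a (s k) j.
    rewrite NE -sumrB.
    by apply: eq_bigr => k _; rewrite /z liftK.
  have := sz (lift ord0 j); rewrite /a.
  have : e * N.+1%:R <= x j / 4 * N.+1%:R.
    by rewrite ler_wpM2r ?(ltW N0)//; have := dx j xj; lra.
  by lra.
Qed.

Lemma mech_rev_le_SRev (L : nat) :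
  (0 < L)%N -> 2 * m%:R <= 2 ^+ L :> R ->
  (mech_rev P V Q (fun w v => p w (c w v)) <= (8 * L%:R)%:E * SRev P V x)%E /\
  (0 <= SRev P V x)%E.
Proof.
move=> L0 mL; have [K K0 vb] := ae_value_bound.
have L0' : (0 : R) < L%:R by rewrite ltr0n.
have S0 : (0 <= SRev P V x)%E.
  have [b b0 bx] := exists_rare_sales K vb.
  apply: le_trans (SRev_ge_average P V x 0 (fun=> guarded x K b) mV _ _).
  - rewrite lee_fin big_ord1 divr1; apply: sumr_ge0 => j _.
    by rewrite mulr_ge0 ?guarded_ge0// sale_prob_ge0.
  - by move=> _ j; exact: guarded_ge0.
  - by move=> j; rewrite big_ord1 mul1r; have := bx j; have := x0 j; lra.
split=> //; rewrite leNgt; apply/negP.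
have quarter t := SRev_ge_quarter K L t K0 vb L0 mL.
case E : (SRev P V x) S0 quarter => [s| |]//= S0 quarter; last first.
  by rewrite gt0_muley ?lte_fin ?mulr_gt0// ltNge leey.
rewrite lee_fin in S0; rewrite -EFinM => lt.
suff [t st tlt] : exists2 t, 4 * s < t &
    ((2 * L%:R * t)%:E < mech_rev P V Q (fun w v => p w (c w v)))%E.
  have t0 : 0 < t by lra.
  by have := quarter t t0 tlt; rewrite lee_fin; lra.
move: lt; case: mech_rev => [r| |]// lt.
  (* The witness is the midpoint of [4 * s] and [r / (2 * L)]. *)
  rewrite lte_fin in lt; exists (2 * s + r / (4 * L%:R)).
    have : s * 2 < r / (4 * L%:R) by rewrite ltr_pdivlMr ?mulr_gt0//; lra.
    by lra.
  rewrite lte_fin mulrDr.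
  have -> : 2 * L%:R * (r / (4 * L%:R)) = r / 2 by field; rewrite gt_eqF.
  by lra.
by exists (4 * s + 1); [lra|rewrite ltry].
Qed.

End Mechanism.

(** * The logarithmic factor and the conclusion *)

(** With [L] the rounded-up logarithm, the claim amounts to [2 ^ L <= (m + 1) ^ 3], which follows
    from [2 ^ (L - 1) < 2 * m]. *)
Lemma up_log2_le_ln {R : realType} (m : nat) : (0 < m)%N ->
  (up_log 2 (2 * m))%:R <= 3 / ln 2 * ln (m.+1)%:R :> R.
Proof.
move=> m0; set L := up_log 2 (2 * m).
have ln2 : 0 < ln (2 : R) by apply: ln_gt0; rewrite ltr1n.
rewrite mulrAC ler_pdivlMr// !mulr_natl -!lnXn//.
rewrite ler_ln ?posrE ?exprn_gt0//.
rewrite -!natrX ler_nat.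
have m2 : (1 < 2 * m)%N by lia.
have := @up_log_gtn 2 _ isT m2; rewrite -/L.
have -> : L = L.-1.+1 by rewrite prednK// up_log_gt0.
rewrite /= expnS; nia.
Qed.

Theorem theorem4 (R : realType) :
  exists C : R, 0 < C /\
  forall (m : nat) (dO : measure_display) (O : measurableType dO)
    (P : probability O R) (V : O -> vec R m) (x : vec R m),
    (forall o, valuation (V o)) ->
    (forall j, measurable_fun setT (fun o => V o j)) ->
    lottery x ->
    (BuyManyRev P V x <= (C * ln (m.+1)%:R)%:E * SRev P V x)%E.
Proof.
have ln2 : 0 < ln (2 : R) by apply: ln_gt0; rewrite ltr1n.
(* The factor 8 of [mech_rev_le_SRev] times the 3 of [up_log2_le_ln]. *)
exists (24 / ln 2); split; first by rewrite divr_gt0.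
move=> m dO O P V x V0 mV x01.
apply: ge_ereal_sup => _ [dW [W [Q [p [c [pP cP ok ->]]]]]].
(* Without items the right-hand side is 0, and the only lottery is the empty one, priced 0. *)
have [m0|m0] := posnP m.
  subst m; rewrite ln1 mulr0 mul0e.
  rewrite /mech_rev integral0_eq// => w _; rewrite integral0_eq// => o _.
  rewrite (_ : c w (V o) = lot0 R (m:=0)) ?(pP w).1.2//.
  by apply/funext => -[].
set L := up_log 2 (2 * m).
have L0 : (0 < L)%N by rewrite up_log_gt0/=; lia.
have mL : 2 * m%:R <= 2 ^+ L :> R.
  by rewrite -natrX -natrM ler_nat; exact: up_logP.
have [le S0] := mech_rev_le_SRev P V x V0 mV x01 Q p c pP cP ok L L0 mL.
apply: (le_trans le); apply: lee_wpmul2r => //; rewrite lee_fin.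
by have := @up_log2_le_ln R m m0; rewrite -/L; lra.
Qed.
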